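(* Let $a$ be an odd integer and let $n=a^2$ (so that $2n=a^2+a^2$). Let $H,K$ be a pair of unbiased complex Hadamard matrices of order $2n$ such that all entries of $HK^*$ lie in $G(a,a)$. Write $H=A+iB$ and $K=C+iD$, where $A,B,C,D$ are $(0,\pm1)$-matrices of order $2n$ such that $A\pm B$ and $C\pm D$ are $\pm1$-matrices. Then the matrices $$H'=\begin{pmatrix}1&1\\1&-1\end{pmatrix}\otimes A+\begin{pmatrix}-1&1\\1&1\end{pmatrix}\otimes B,\qquad K'=\begin{pmatrix}1&1\\1&-1\end{pmatrix}\otimes C+\begin{pmatrix}-1&1\\1&1\end{pmatrix}\otimes D$$ form a pair of unbiased (real) Hadamard matrices of order $4n=4a^2$.
   Context: A complex Hadamard matrix of order $m$ is an $m\times m$ matrix with all entries in $\{1,-1,i,-i\}$ whose rows are pairwise orthogonal in the usual complex inner product on $\mathbb{C}^m$ (so $HH^*=mI$, where $H^*$ is the Hermitian transpose). A (real) Hadamard matrix is a complex Hadamard matrix with all entries in $\{1,-1\}$. Two complex Hadamard matrices $H,K$ of order $m$ ($m$ even) are called unbiased if every entry of $HK^*$ has absolute value $\sqrt{m}$. Two real Hadamard matrices $H,K$ of order $m$ are called unbiased if every entry of $HK^t$ has absolute value $\sqrt{m}$. For integers $a,b$, $G(a,b)=\{a\pm ib,\,-a\pm ib,\,ia\pm b,\,-ia\pm b\}$. Here $\otimes$ is the Kronecker product. The matrices $A,B$ (resp. $C,D$) are the entrywise real and imaginary parts of $H$ (resp. $K$). *)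

(* Defs.v *)
From mathcomp Require Import all_boot all_order all_algebra spectral.
From mathcomp Require Export reals.
From mathcomp Require Export complex.
From mathcomp Require mxtens.

Set Implicit Arguments.
Unset Strict Implicit.
Unset Printing Implicit Defensive.

Import Order.TTheory GRing.Theory Num.Theory.
Local Open Scope ring_scope.
Local Open Scope sesquilinear_scope.

Section Hadamard.
Variable C : numClosedFieldType.

(* Orthogonality of all pairs of distinct rows, for the Hermitian product
   dotmx u v = \sum_k u_k * (v_k)^*. *)
Definition orthogonal_rows m (H : 'M[C]_m) : Prop :=
  forall i j : 'I_m, i != j -> dotmx (row i H) (row j H) = 0.

Definition complex_hadamard m (H : 'M[C]_m) : Prop :=
  (forall i j : 'I_m, H i j \in [:: 1; -1; 'i; - 'i]) /\ orthogonal_rows H.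

Definition pm1_mx m (M : 'M[C]_m) : Prop :=
  forall i j : 'I_m, M i j \in [:: 1; -1].

Definition zero_pm1_mx m (M : 'M[C]_m) : Prop :=
  forall i j : 'I_m, M i j \in [:: 0; 1; -1].

Definition real_hadamard m (H : 'M[C]_m) : Prop :=
  complex_hadamard H /\ pm1_mx H.

Definition unbiased_complex_hadamard m (H K : 'M[C]_m) : Prop :=
  [/\ ~~ odd m, complex_hadamard H, complex_hadamard K
    & forall i j : 'I_m, `|(H *m K ^t*) i j| = sqrtC m%:R].

Definition unbiased_real_hadamard m (H K : 'M[C]_m) : Prop :=
  [/\ real_hadamard H, real_hadamard K
    & forall i j : 'I_m, `|(H *m K^T) i j| = sqrtC m%:R].

Definition gaussG (a b : int) : seq C :=
  let x := a%:~R in let y := b%:~R in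
  [:: x + 'i * y; x - 'i * y; - x + 'i * y; - x - 'i * y;
      'i * x + y; 'i * x - y; - ('i * x) + y; - ('i * x) - y].

(* Entrywise real and imaginary parts, kept as matrices over C. *)
Definition re_mx m (H : 'M[C]_m) : 'M[C]_m := map_mx (fun z => 'Re z) H.
Definition im_mx m (H : 'M[C]_m) : 'M[C]_m := map_mx (fun z => 'Im z) H.

Definition mx22 (a b c d : C) : 'M[C]_2 :=
  block_mx a%:M b%:M c%:M (d%:M : 'M_1).

Definition doubling m (A B : 'M[C]_m) : 'M[C]_(2 * m) :=
  mxtens.tensmx (mx22 1 1 1 (-1)) A + mxtens.tensmx (mx22 (-1) 1 1 1) B.

End Hadamard.

(* Main.v *)
Require Import Defs.
From mathcomp Require Import all_boot all_order all_algebra spectral.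
From mathcomp Require Import ring.

(** Put P = [[1, 1], [1, -1]] and Q = [[-1, 1], [1, 1]].  The doubled matrix of
    H = A + iB is P (x) A + Q (x) B.  Since
      P P^T = Q Q^T = 2 I   and   P Q^T = - Q P^T = [[0, 2], [-2, 0]],
    multiplying two doubled matrices H', K' gives
      H' K'^T = 2 I (x) Re (H K^* ) + [[0, -2], [2, 0]] (x) Im (H K^* )
    ([doubling_mul_tr]): up to the factor 2 this is the usual representation of
    complex numbers by real 2 x 2 matrices, applied to H K^*.  So every entry of
    H' K'^T is, up to sign, twice the real or the imaginary part of an entry of
    H K^*, and everything is read off from this identity.

    - The entries of H' are, up to sign, those of A + B and A - B, hence are
      1 or -1, because H has entries in {1, -1, i, -i}.
    - Taking K = H, off-diagonal entries of H H^* vanish and diagonal ones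
      are real, so H' H'^T is diagonal ([real_hadamard_doubling]).
    - An element of G(a, a) has real and imaginary parts equal to a or -a, so
      all entries of H' K'^T have absolute value 2|a|, the square root of
      4 a^2, the order of H' and K' ([unbiased_doubling]). *)

Import Order.TTheory GRing.Theory Num.Theory.
Local Open Scope ring_scope.
Local Open Scope sesquilinear_scope.

Section Doubling.
Variable C : numClosedFieldType.

Lemma re_im_mx m (H : 'M[C]_m) : H = re_mx H + 'i *: im_mx H.
Proof. by apply/matrixP=> i j; rewrite !mxE -Crect. Qed.

Lemma re_mx_mul_adj m (H K : 'M[C]_m) :
  re_mx (H *m K ^t*)
  = re_mx H *m (re_mx K)^T + im_mx H *m (im_mx K)^T.
Proof.
apply/matrixP=> i j; rewrite !mxE raddf_sum -big_split /=.
by apply: eq_bigr => k _; rewrite !mxE ReM Re_conj Im_conj mulrN opprK.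
Qed.

Lemma im_mx_mul_adj m (H K : 'M[C]_m) :
  im_mx (H *m K ^t*)
  = im_mx H *m (re_mx K)^T - re_mx H *m (im_mx K)^T.
Proof.
apply/matrixP=> i j; rewrite !mxE raddf_sum -sumrB /=.
apply: eq_bigr => k _; rewrite !mxE ImM Re_conj Im_conj.
by rewrite mulrN addrC mulrC.
Qed.

Lemma mx22E (a b c d : C) (s t : 'I_2) :
  mx22 a b c d s t = if s == 0 then if t == 0 then a else b
                     else if t == 0 then c else d.
Proof.
rewrite /mx22 mxE -!val_eqE.
case: splitP => p /= ->; rewrite !mxE; case: splitP => q /= ->;
  by rewrite !ord1 !mxE eqxx.
Qed.

Lemma mulmx22_tr (a b c d a' b' c' d' : C) :
  mx22 a b c d *m (mx22 a' b' c' d')^T =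
  mx22 (a * a' + b * b') (a * c' + b * d') (c * a' + d * b') (c * c' + d * d').
Proof.
apply/matrixP=> s t; rewrite mxE mx22E.
under eq_bigr do rewrite [_^T _ _]mxE !mx22E.
rewrite !big_ord_recl big_ord0 addr0 /=.
by case: (s == 0); case: (t == 0).
Qed.

(** The mixed-product rule for Kronecker products turns the left-hand side into
    four terms; the two with equal factors P P^T, Q Q^T add up to the real part
    of H K^*, the two with mixed factors to its imaginary part. *)
Lemma doubling_mul_tr m (H K : 'M[C]_m) :
  doubling (re_mx H) (im_mx H) *m (doubling (re_mx K) (im_mx K))^T
  = mxtens.tensmx (mx22 2 0 0 2) (re_mx (H *m K ^t*))
    + mxtens.tensmx (mx22 0 (- 2) 2 0) (im_mx (H *m K ^t*)).
Proof.
rewrite re_mx_mul_adj im_mx_mul_adj /doubling raddfD /= !mxtens.trmx_tens.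
rewrite mulmxDl !mulmxDr !mxtens.tensmx_mul !mulmx22_tr.
apply/matrixP=> x y.
rewrite [LHS]mxE [X in X + _ = _]mxE [X in _ + X = _]mxE [RHS]mxE.
case: (mxtens.mxtens_indexP x) => s i; case: (mxtens.mxtens_indexP y) => t j.
rewrite !mxtens.tensmxE ![(_ + _ : 'M_m) i j]mxE [(- _ : 'M_m) i j]mxE !mx22E.
by case: (s == 0); case: (t == 0); ring.
Qed.

Lemma unit_re_im (z : C) : z \in [:: 1; -1; 'i; - 'i] ->
  [/\ 'Re z \in [:: 0; 1; -1], 'Im z \in [:: 0; 1; -1],
      'Re z + 'Im z \in [:: 1; -1] & 'Re z - 'Im z \in [:: 1; -1]].
Proof.
have Re1 : 'Re (1 : C) = 1 by apply/Creal_ReP.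
have Im1 : 'Im (1 : C) = 0 by apply/Creal_ImP.
rewrite !inE => /or4P[] /eqP->;
  rewrite ?raddfN /= ?Re1 ?Im1 ?Re_i ?Im_i;
  rewrite ?(oppr0, opprK, addr0, add0r, subr0, sub0r, eqxx, orbT) //.
Qed.

Lemma hadamard_re_im m (H : 'M[C]_m) : complex_hadamard H ->
  [/\ zero_pm1_mx (re_mx H), zero_pm1_mx (im_mx H),
      pm1_mx (re_mx H + im_mx H) & pm1_mx (re_mx H - im_mx H)].
Proof.
case=> unitH _; split=> i j; rewrite !mxE;
  by have [] := unit_re_im _ (unitH i j).
Qed.

Lemma hadamard_mul_adj m (H : 'M[C]_m) i j : complex_hadamard H ->
  i != j -> (H *m H ^t*) i j = 0.
Proof.
case=> _ orthoH /orthoH; rewrite dotmxE => <-; rewrite !mxE.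
by apply: eq_bigr => k _; rewrite !mxE.
Qed.

Lemma mul_adj_diag_real m (H : 'M[C]_m) i : (H *m H ^t*) i i \is Num.real.
Proof.
by rewrite mxE rpred_sum // => k _; rewrite !mxE -normCK rpredX ?normr_real.
Qed.

(** In each position exactly one of A + B, A - B, up to sign, is produced,
    because the coefficient pairs of the four blocks are (1, -1), (1, 1),
    (1, 1), (-1, 1). *)
Lemma pm1_doubling m (A B : 'M[C]_m) :
  pm1_mx (A + B) -> pm1_mx (A - B) -> pm1_mx (doubling A B).
Proof.
have pm1N (z : C) : (- z \in [:: 1; -1]) = (z \in [:: 1; -1]).
  by rewrite !inE eqr_oppLR eqr_opp orbC.
move=> pmD pmB x y.
case: (mxtens.mxtens_indexP x) => s i; case: (mxtens.mxtens_indexP y) => t j.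
rewrite /doubling mxE !mxtens.tensmxE !mx22E.
have := pmB i j; have := pmD i j; rewrite !mxE => zD zB.
case: (s == 0); case: (t == 0); rewrite ?mul1r ?mulN1r //.
by rewrite -pm1N opprD opprK.
Qed.

Lemma pm1_dotmx_row m (M : 'M[C]_m) i j :
  pm1_mx M -> dotmx (row i M) (row j M) = (M *m M^T) i j.
Proof.
move=> pmM; rewrite dotmxE !mxE; apply: eq_bigr => k _; rewrite !mxE.
congr (_ * _); apply/CrealP.
by have := pmM j k; rewrite !inE => /orP[] /eqP->; rewrite ?rpredN rpred1.
Qed.

(** Off the diagonal, H' H'^T only meets off-diagonal entries of H H^*, which
    vanish, and the imaginary parts of its diagonal entries, which are sums of
    squared moduli. *)
Lemma real_hadamard_doubling m (H : 'M[C]_m) :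
  complex_hadamard H -> real_hadamard (doubling (re_mx H) (im_mx H)).
Proof.
move=> hadH; have [_ _ pmD pmB] := hadamard_re_im _ _ hadH.
have pmH' := pm1_doubling _ _ _ pmD pmB; split=> //; split=> [x y|x y neq_xy].
  by have := pmH' x y; rewrite !inE => /orP[] ->; rewrite ?orbT.
rewrite pm1_dotmx_row // doubling_mul_tr; move: neq_xy.
case: (mxtens.mxtens_indexP x) => s i; case: (mxtens.mxtens_indexP y) => t j.
rewrite mxE !mxtens.tensmxE [re_mx _ i j]mxE [im_mx _ i j]mxE !mx22E.
have [<-{j}|neq_ij] := eqVneq i j; last first.
  by rewrite (hadamard_mul_adj _ _ _ _ hadH neq_ij) !raddf0 !mulr0 addr0.
have /Creal_ImP-> := mul_adj_diag_real _ H i; rewrite mulr0 addr0.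
(* Same row of H: only the block indices s, t can differ, and then the
   coefficient of the real part is 0. *)
case: s t => [[|[|//]] ltS] [[|[|//]] ltT] /=; rewrite ?mul0r //;
  by case/negP; apply/eqP; apply: val_inj.
Qed.

(** With both parameters equal to a, exchanging the roles of the real and the
    imaginary part makes no difference to their absolute values; this is why a
    2 x 2 doubling suffices when both squares in the decomposition of the order
    agree. *)
Lemma gaussG_norm_re_im (a : int) (z : C) : z \in gaussG C a a ->
  `|'Re z| = `|a%:~R| /\ `|'Im z| = `|a%:~R|.
Proof.
have ra : (a%:~R : C) \is Num.real by rewrite realz.
rewrite !inE; do 7?[case/orP]; move/eqP=> ->;
  rewrite !(raddfD, raddfN) /= ?ReMil ?ImMil !(Creal_ReP _ ra) !(Creal_ImP _ ra);
  by rewrite ?(oppr0, addr0, add0r, normrN).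
Qed.

Lemma unbiased_doubling (a : int) m (H K : 'M[C]_m) :
  m%:R = 2 * a%:~R ^+ 2 :> C ->
  complex_hadamard H -> complex_hadamard K ->
  (forall i j, (H *m K ^t*) i j \in gaussG C a a) ->
  unbiased_real_hadamard (doubling (re_mx H) (im_mx H))
                         (doubling (re_mx K) (im_mx K)).
Proof.
move=> def_m hadH hadK inG; split; try exact: real_hadamard_doubling.
move=> x y; rewrite doubling_mul_tr.
case: (mxtens.mxtens_indexP x) => s i; case: (mxtens.mxtens_indexP y) => t j.
rewrite mxE !mxtens.tensmxE [re_mx _ i j]mxE [im_mx _ i j]mxE !mx22E.
have -> : sqrtC (2 * m)%:R = 2 * `|a%:~R| :> C.
  have -> : (2 * m)%:R = (2 * `|a%:~R|) ^+ 2 :> C.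
    by rewrite natrM def_m exprMn real_normK ?realz //; ring.
  by rewrite sqrCK // mulr_ge0.
have [normRe normIm] := gaussG_norm_re_im _ _ (inG i j).
by case: (s == 0); case: (t == 0);
  rewrite ?mul0r ?add0r ?addr0 normrM ?normrN ?normRe ?normIm normr_nat.
Qed.

End Doubling.

Local Open Scope complex_scope.

Theorem theorem16 (R : realType) (a : int) (n : nat)
    (ha : ~~ (2 %| a)%Z) (hn : n%:Z = a ^+ 2)
    (H K : 'M[R[i]]_(2 * n))
    (hHK : unbiased_complex_hadamard H K)
    (hG : forall i j : 'I_(2 * n), (H *m K ^t*) i j \in gaussG R[i] a a) :
  let A := re_mx H in let B := im_mx H in
  let C := re_mx K in let D := im_mx K in
  [/\ H = A + 'i%R *: B, zero_pm1_mx A, zero_pm1_mx B, pm1_mx (A + B)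
    & pm1_mx (A - B)] /\
  [/\ K = C + 'i%R *: D, zero_pm1_mx C, zero_pm1_mx D, pm1_mx (C + D)
    & pm1_mx (C - D)] /\
  unbiased_real_hadamard (doubling A B) (doubling C D).
Proof.
move=> A B C D; case: hHK => _ hadH hadK _.
have [A01 B01 ABD ABB] := hadamard_re_im _ _ _ hadH.
have [C01 D01 CDD CDB] := hadamard_re_im _ _ _ hadK.
have def_2n : (2 * n)%:R = 2 * a%:~R ^+ 2 :> R[i].
  by rewrite natrM -rmorphXn /= -hn pmulrn.
split; first by split=> //; apply: re_im_mx.
split; first by split=> //; apply: re_im_mx.
exact: unbiased_doubling def_2n hadH hadK hG.
Qed.
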